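(* For non-negative integer $L$ and integer $a$, \[ \sum_{i\geq 0} q^{\binom{i+1}{2}} {L\brack i}_q \left\{ T_{-1}\left(\begin{array}{c}i\\ a \end{array};q \right) + T_{-1}\left(\begin{array}{c}i\\ a+1 \end{array};q \right) \right\} = q^{\binom{a+1}{2}} {2L+1\brack L-a}_q. \]
   Context: Notation: $(a;q)_n=(1-a)(1-aq)\cdots(1-aq^{n-1})$ with $1/(q;q)_n=0$ for $n<0$. The $q$-binomial coefficient is ${m+n\brack m}_q=\frac{(q;q)_{m+n}}{(q;q)_m(q;q)_n}$ for $m,n\geq 0$ and $0$ otherwise. The $q$-trinomial coefficient is $\left(\begin{array}{c}L,\, b\\ a \end{array};q\right)_2 = \sum_{n\geq 0} q^{n(n+b)} \frac{(q;q)_L}{(q;q)_n(q;q)_{n+a}(q;q)_{L-2n-a}}$, and for an integer $n$, $T_n\left(\begin{array}{c}L\\ a\end{array};q\right) = q^{(L(L-n)-a(a-n))/2}\left(\begin{array}{c}L,\, a-n\\ a \end{array};1/q\right)_2$. *)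

(* Defs.v *)
From HB Require Import structures.
From mathcomp Require Import all_boot all_order all_algebra.
From mathcomp Require Import boolp classical_sets functions cardinality fsbigop.
From mathcomp Require Import zify.

Set Implicit Arguments.
Unset Strict Implicit.
Unset Printing Implicit Defensive.

Import Order.TTheory GRing.Theory Num.Theory.

Local Open Scope ring_scope.
Local Open Scope classical_set_scope.

Section QSeries.
Variable F : fieldType.
Implicit Types q r : F.

Definition qpoch (a q : F) (n : nat) : F := \prod_(i < n) (1 - a * q ^+ i).

(* 1 / (q;q)_n for n in Z, with the convention 1 / (q;q)_n = 0 for n < 0 *)
Definition inv_qfact q (n : int) : F :=
  if 0 <= n then (qpoch q q `|n|%N)^-1 else 0.

(* [m+n brack m]_q is [qbinom q (m + n) m]: the guard says m >= 0 and n >= 0 *)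
Definition qbinom q (N m : int) : F :=
  if (0 <= m) && (0 <= N - m)
  then qpoch q q `|N|%N / (qpoch q q `|m|%N * qpoch q q `|N - m|%N)
  else 0.

(* The sum over n in N has finite support: see [qtrinomE]. *)
Definition qtrinom q (L : nat) (b a : int) : F :=
  \sum_(n \in [set: nat])
    q ^ (n%:Z * (n%:Z + b)) *
    (qpoch q q L * inv_qfact q n%:Z * inv_qfact q (n%:Z + a)
      * inv_qfact q (L%:Z - 2 * n%:Z - a)).

(* T_n(L, a; q), where r is a square root of q: r ^ k stands for q^(k/2), as
   (L(L-n) - a(a-n))/2 may be a half-integer when n is even. *)
Definition qT q r (n : int) (L : nat) (a : int) : F :=
  r ^ (L%:Z * (L%:Z - n) - a * (a - n)) * qtrinom q^-1 L (a - n) a.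

Lemma fsbig_nat_ord (f : nat -> F) (N : nat) :
    (forall i, (N <= i)%N -> f i = 0) ->
  \sum_(i \in [set: nat]) f i = \sum_(i < N) f i.
Proof.
move=> f0; rewrite -(big_mkord xpredT f) (fsbigE (index_iota 0 N)) ?iota_uniq //.
  by apply: eq_bigl => i; rewrite in_setT.
by move=> i _; rewrite mem_index_iota /= -leqNgt => /f0.
Qed.

Lemma inv_qfact_lt0 q (n : int) : n < 0 -> inv_qfact q n = 0.
Proof. by rewrite /inv_qfact ltNge => /negbTE ->. Qed.

Lemma qbinom_gt q (L i : nat) : (L < i)%N -> qbinom q L%:Z i%:Z = 0.
Proof. by move=> ltLi; rewrite /qbinom; case: ifP => // /andP[_]; lia. Qed.

Lemma qtrinomE q (L : nat) (b a : int) :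
  qtrinom q L b a =
  \sum_(n < L.+1)
    q ^ (n%:Z * (n%:Z + b)) *
    (qpoch q q L * inv_qfact q n%:Z * inv_qfact q (n%:Z + a)
      * inv_qfact q (L%:Z - 2 * n%:Z - a)).
Proof.
rewrite /qtrinom (@fsbig_nat_ord _ L.+1) // => n ltLn.
have [na0|na0] := ltP (n%:Z + a) 0.
  by rewrite (inv_qfact_lt0 _ na0) !(mulr0, mul0r).
have La0 : L%:Z - 2 * n%:Z - a < 0 by lia.
by rewrite (inv_qfact_lt0 _ La0) !mulr0.
Qed.

End QSeries.

(* Main.v *)
Require Import Defs.
From HB Require Import structures.
From mathcomp Require Import all_boot all_order all_algebra.
From mathcomp Require Import boolp classical_sets functions cardinality fsbigop.
From mathcomp Require Import zify ring.

Set Implicit Arguments.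
Unset Strict Implicit.
Unset Printing Implicit Defensive.

Import Order.TTheory GRing.Theory Num.Theory.

Local Open Scope ring_scope.
Local Open Scope classical_set_scope.

(* Passing from 1/q to q, T_{-1}(i, a) = (q)_i times the sum over n of
   q^(k(k+1)/2) / ((q)_n (q)_{n+a} (q)_k) with k = i - 2n - a, whence
     T(i, a-1) + T(i, a+1) = T(i+1, a) - q^(i+1) T(i, a) + (1 - q^i) T(i-1, a).
   Combined with a recurrence in L for the weights q^binom(i+1, 2) [L, i], this
   shows that S_L(a), the sum over i of the weighted T(i, a), satisfies
     S_{L+1}(a) = (1 + q^(2L+2)) S_L(a) + q^(L+1) (S_L(a-1) + S_L(a+1)),
   i.e. S_L(a) is the coefficient of z^a in (-zq)_L (-q/z)_L.  The right-hand
   side of the theorem satisfies the same recurrence, by two applications of the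
   q-Pascal rules, and the case L = 0 is immediate. *)

(** * Triangular numbers over the integers *)

(** Extends binom(k+1, 2) to negative [k]. The division is exact, as [tri_half] shows. *)
Definition tri (k : int) : int := ((k + 1) * k %/ 2)%Z.

Lemma triD1 (k : int) : tri (k + 1) = tri k + (k + 1).
Proof.
rewrite /tri (_ : (k + 1 + 1) * (k + 1) = (k + 1) * 2 + (k + 1) * k) /=;
  last by ring.
by rewrite divzMDl // addrC.
Qed.

Lemma tri_half (k : int) : tri k * 2 = (k + 1) * k.
Proof.
elim/int_ind: k => [|n IHn|n IHn]; first by rewrite /tri mulr0 div0z.
  by rewrite intS addrC triD1 mulrDl IHn; ring.
have := triD1 (- n.+1%:Z); rewrite (_ : - n.+1%:Z + 1 = - n%:Z); last by lia.
move=> trin; have -> : tri (- n.+1%:Z) = tri (- n%:Z) + n%:Z.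
  by rewrite trin; ring.
by rewrite mulrDl IHn intS; ring.
Qed.

Lemma triD (m n : int) : tri (m + n) = tri m + tri n + m * n.
Proof.
apply: (mulIf (_ : 2 != 0 :> int)) => //.
by rewrite !mulrDl !tri_half; ring.
Qed.

Lemma tri_nat (i : nat) : tri i%:Z = 'C(i.+1, 2)%:Z.
Proof.
elim: i => [|i IHi]; first by rewrite /tri mulr0 div0z.
by rewrite (binS i.+1) bin1 intS addrC triD1 IHi; lia.
Qed.

Section QSeriesTheory.
Variables (F : fieldType) (q : F).
Hypothesis q_neq0 : q != 0.
Hypothesis q_nroot : forall n : nat, (0 < n)%N -> q ^+ n != 1.

(** * Reciprocal q-factorials and their recurrences *)

Local Notation e := (inv_qfact q).
(** Up to the sign (-1)^k this is the reciprocal q-factorial in base 1/q; see [inv_qfactV]. *)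
Definition tri_inv_qfact (k : int) : F := q ^ tri k * e k.

Lemma qpochS (n : nat) : qpoch q q n.+1 = qpoch q q n * (1 - q ^+ n.+1).
Proof. by rewrite /qpoch big_ord_recr /= exprS. Qed.

(** At [n = 0] the factor 1 - q^0 agrees with the convention 1/(q)_{-1} = 0, so the rule holds on
    all integers and later recurrences need no boundary cases. *)
Lemma inv_qfactB1 (n : int) : e (n - 1) = (1 - q ^ n) * e n.
Proof.
case: n => [[|n]|n]; first by rewrite inv_qfact_lt0 // subrr mul0r.
  rewrite (_ : n.+1%:Z - 1 = n%:Z); last by lia.
  rewrite /inv_qfact /= qpochS invfM mulrCA divff ?mulr1 //.
  by rewrite subr_eq0 eq_sym q_nroot.
by rewrite !inv_qfact_lt0 ?mulr0 //; lia.
Qed.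

Lemma tri_inv_qfactB1 (k : int) :
  q ^ k * tri_inv_qfact (k - 1) = (1 - q ^ k) * tri_inv_qfact k.
Proof.
have trik : tri k = tri (k - 1) + k by rewrite -{1}(subrK 1 k) triD1 subrK.
by rewrite /tri_inv_qfact inv_qfactB1 trik expfzDr //; ring.
Qed.

(* With x = q ^ n, y = q ^ m and z = q ^ k, this is
   1 - xyz = (1 - y) + (1 - x) + xy (1 - z) - (1 - x) (1 - y). *)
Lemma inv_qfact_trinom_rec (n m k : int) :
  (1 - q ^ (n + m + k)) * (e n * e m * tri_inv_qfact k) =
  e n * e (m - 1) * tri_inv_qfact k + e (n - 1) * e m * tri_inv_qfact k
  + q ^ (n + m + k) * (e n * e m * tri_inv_qfact (k - 1)) 
  - e (n - 1) * e (m - 1) * tri_inv_qfact k.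
Proof.
rewrite !inv_qfactB1 !expfzDr //.
have -> : q ^ n * q ^ m * q ^ k * (e n * e m * tri_inv_qfact (k - 1)) =
  q ^ n * q ^ m * (e n * e m * (q ^ k * tri_inv_qfact (k - 1))) by ring.
rewrite tri_inv_qfactB1; ring.
Qed.

(* The sum over n is truncated at an arbitrary N, so that the shift n -> n - 1
   in the recurrence below needs no condition on i and a. *)
Definition trinom_sum (N : nat) (i a : int) : F :=
  \sum_(n < N) e n%:Z * e (n%:Z + a) * tri_inv_qfact (i - 2 * n%:Z - a).

(** Sums [inv_qfact_trinom_rec] with m = n + a and k = i + 1 - 2n - a, so that n + m + k = i + 1.
    Terms containing [e (n - 1)] vanish at n = 0 and are reindexed, which lowers the truncation by
    one. *)
Lemma trinom_sum_rec (N : nat) (i a : int) :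
  (1 - q ^ (i + 1)) * trinom_sum N.+1 (i + 1) a =
  trinom_sum N.+1 i (a - 1) + trinom_sum N i (a + 1)
  + q ^ (i + 1) * trinom_sum N.+1 i a  - trinom_sum N (i - 1) a.
Proof.
have shift (b j : int) : trinom_sum N j b =
    \sum_(n < N.+1) e (n%:Z - 1) * e (n%:Z + b - 1)
      * tri_inv_qfact (j + 2 - 2 * n%:Z - b).
  rewrite big_ord_recl /= (inv_qfact_lt0 q (n := 0 - 1)) // !mul0r add0r.
  apply: eq_bigr => n _; rewrite /bump leq0n.
  by congr (e _ * e _ * tri_inv_qfact _); lia.
rewrite !shift /trinom_sum !mulr_sumr -!big_split -sumrB /=; apply: eq_bigr => n _.
have := inv_qfact_trinom_rec n%:Z (n%:Z + a) (i + 1 - 2 * n%:Z - a).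
rewrite (_ : _ + _ + (i + 1 - _ - a) = i + 1) => [->|]; last by ring.
by congr (_ * e _ * tri_inv_qfact _ + _ * e _ * tri_inv_qfact _
          + _ * (_ * tri_inv_qfact _) - _ * tri_inv_qfact _); lia.
Qed.

(** For n > i, n + a and i - 2n - a = (i - n) - (n + a) cannot both be non-negative. *)
Lemma trinom_sum_widen (N M : nat) (i a : int) :
  i < N%:Z -> (N <= M)%N -> trinom_sum M i a = trinom_sum N i a.
Proof.
move=> ltiN leNM; pose g (n : nat) :=
  e n%:Z * e (n%:Z + a) * tri_inv_qfact (i - 2 * n%:Z - a).
rewrite /trinom_sum (big_ord_widen _ g leNM) [RHS]big_mkcond.
apply: eq_bigr => n _; case: ifP => // /negbT; rewrite -leqNgt => leNn.
have [na0|na0] := ltP (n%:Z + a) 0.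
  by rewrite (inv_qfact_lt0 _ na0) mulr0 mul0r.
by rewrite /tri_inv_qfact (inv_qfact_lt0 q (n := i - _ - a)) ?mulr0 //; lia.
Qed.

Definition trinomT (i : nat) (a : int) : F :=
  qpoch q q i * trinom_sum i.+1 i%:Z a.

Lemma trinomT_rec (i : nat) (a : int) :
  trinomT i (a - 1) + trinomT i (a + 1) =
  trinomT i.+1 a - q ^+ i.+1 * trinomT i a + (1 - q ^+ i) * trinomT i.-1 a.
Proof.
have rec := trinom_sum_rec i.+1 i%:Z a.
rewrite !(@trinom_sum_widen i.+1 i.+2 i%:Z) ?ltz_nat // in rec.
have -> : (1 - q ^+ i) * trinomT i.-1 a = qpoch q q i * trinom_sum i.+1 (i%:Z - 1) a.
  (* For i = 0 the left side has the factor 1 - q^0, and on the right the sum at -1 is empty; the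
     truncated [0.-1] is harmless. *)
  case: i {rec} => [|i]; last first.
    rewrite (_ : i.+1%:Z - 1 = i%:Z); last by lia.
    by rewrite (@trinom_sum_widen i.+1 i.+2) ?ltz_nat // /trinomT /= qpochS; ring.
  by rewrite subrr mul0r (@trinom_sum_widen 0) // /trinom_sum big_ord0 mulr0.
have i1 : i%:Z + 1 = i.+1%:Z by lia.
rewrite i1 -exprnP in rec.
have -> : trinomT i.+1 a = qpoch q q i * ((1 - q ^+ i.+1) * trinom_sum i.+2 i.+1%:Z a).
  by rewrite /trinomT qpochS mulrA.
rewrite rec /trinomT; ring.
Qed.

(** * The weights and the transformed sum *)

Definition qbinom_tri (L : nat) (i : int) : F :=
  qpoch q q L * tri_inv_qfact i * e (L%:Z - i).

(** The bracket is the adjoint, under summation over i, of the operator in [trinomT_rec]. Every term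
    is a multiple of (q)_L [tri_inv_qfact i] / (q)_{L+1-i}, which leaves a rational identity in q^i
    and q^(L+1-i). *)
Lemma qbinom_tri_rec (L : nat) (i : int) :
  qbinom_tri L.+1 i = (1 + q ^+ L.+1 ^+ 2) * qbinom_tri L i
    + q ^+ L.+1 * (qbinom_tri L (i - 1) - q ^ (i + 1) * qbinom_tri L i
                   + (1 - q ^ (i + 1)) * qbinom_tri L (i + 1)).
Proof.
have qi0 : q ^ i != 0 by rewrite expfz_neq0.
have pred_i : tri_inv_qfact (i - 1) = (1 - q ^ i) * tri_inv_qfact i / q ^ i.
  by rewrite -tri_inv_qfactB1 mulrAC divff ?mul1r.
have succ_i : (1 - q ^ (i + 1)) * tri_inv_qfact (i + 1) =
    q ^ (i + 1) * tri_inv_qfact i.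
  by rewrite -tri_inv_qfactB1 addrK.
have -> : (1 - q ^ (i + 1)) * qbinom_tri L (i + 1) =
    qpoch q q L * (q ^ (i + 1) * tri_inv_qfact i) * e (L%:Z - (i + 1)).
  by rewrite -succ_i /qbinom_tri; ring.
have qL : q ^+ L.+1 = q ^ (L.+1%:Z - i) * q ^ i by rewrite -expfzDr // subrK.
rewrite /qbinom_tri pred_i qpochS qL.
have -> : L%:Z - i = L.+1%:Z - i - 1 by lia.
have -> : L%:Z - (i - 1) = L.+1%:Z - i by lia.
have -> : L%:Z - (i + 1) = L.+1%:Z - i - 1 - 1 by lia.
rewrite !inv_qfactB1 (expfzDr (L.+1%:Z - i) (- 1)) // (expfzDr i 1) // exprN1 expr1z.
by field; rewrite ?qi0 ?q_neq0.
Qed.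

Definition trinomT_transform (L : nat) (a : int) : F :=
  \sum_(i < L.+1) qbinom_tri L i%:Z * trinomT i a.

Lemma trinomT_transform_rec (L : nat) (a : int) :
  trinomT_transform L.+1 a = (1 + q ^+ L.+1 ^+ 2) * trinomT_transform L a
    + q ^+ L.+1 * (trinomT_transform L (a - 1) + trinomT_transform L (a + 1)).
Proof.
have coef_neg : qbinom_tri L (- 1) = 0.
  rewrite /qbinom_tri /tri_inv_qfact.
  by rewrite (inv_qfact_lt0 q (n := - 1)) // !(mulr0, mul0r).
have coef_gt (i : nat) : (L < i)%N -> qbinom_tri L i%:Z = 0.
  by move=> ltLi; rewrite /qbinom_tri (inv_qfact_lt0 q (n := L%:Z - _)) ?mulr0 //; lia.
have widenL (b : int) : trinomT_transform L b =
    \sum_(i < L.+2) qbinom_tri L i%:Z * trinomT i b.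
  by rewrite big_ord_recr /= coef_gt // mul0r addr0.
(* Summation by parts: [up] and [down] move the shifts in i from the weights to [trinomT]. The
   boundary terms vanish, by [coef_neg], [coef_gt] and 1 - q^0 = 0. *)
have up : \sum_(i < L.+2) qbinom_tri L (i%:Z - 1) * trinomT i a =
    \sum_(i < L.+2) qbinom_tri L i%:Z * trinomT i.+1 a.
  rewrite big_ord_recl [RHS]big_ord_recr /= coef_neg (coef_gt L.+1) //.
  rewrite !mul0r add0r addr0.
  apply: eq_bigr => i _; rewrite /bump leq0n; congr (qbinom_tri _ _ * _); lia.
have down : \sum_(i < L.+2) (1 - q ^ (i%:Z + 1)) * qbinom_tri L (i%:Z + 1)
      * trinomT i a =
    \sum_(i < L.+2) qbinom_tri L i%:Z * ((1 - q ^+ i) * trinomT i.-1 a).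
  rewrite big_ord_recr [RHS]big_ord_recl /= subrr mul0r mulr0 add0r.
  rewrite (_ : L.+1%:Z + 1 = L.+2%:Z) ?coef_gt //; last by lia.
  rewrite mulr0 mul0r addr0; apply: eq_bigr => i _; rewrite /bump leq0n add1n /=.
  by rewrite (_ : i%:Z + 1 = i.+1%:Z) -?exprnP; [ring | lia].
have conv : trinomT_transform L (a - 1) + trinomT_transform L (a + 1) =
    \sum_(i < L.+2) (qbinom_tri L (i%:Z - 1)
      - q ^ (i%:Z + 1) * qbinom_tri L i%:Z
      + (1 - q ^ (i%:Z + 1)) * qbinom_tri L (i%:Z + 1)) * trinomT i a.
  under eq_bigr do rewrite mulrDl mulrBl.
  rewrite big_split sumrB /= up down !widenL.
  rewrite -big_split -sumrB -big_split /=.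
  apply: eq_bigr => i _; rewrite -mulrDr trinomT_rec.
  by rewrite (_ : i%:Z + 1 = i.+1%:Z) -?exprnP; [ring | lia].
rewrite conv widenL /trinomT_transform !mulr_sumr -big_split /=.
by apply: eq_bigr => i _; rewrite qbinom_tri_rec; ring.
Qed.

(** * The q-Pascal rules and the right-hand side *)

Lemma qbinomE (N : nat) (m : int) :
  qbinom q N%:Z m = qpoch q q N * (e m * e (N%:Z - m)).
Proof.
rewrite /qbinom /inv_qfact; case: (0 <= m) => /=; last by rewrite mul0r mulr0.
by case: (0 <= _); rewrite ?mulr0 // invfM.
Qed.

(** With x = q^(N+1-m) and y = q^m this is 1 - xy = (1 - x) + x (1 - y); [qbinomSr] exchanges x and
    y. *)
Lemma qbinomSl (N : nat) (m : int) :
  qbinom q N.+1%:Z m = qbinom q N%:Z m + q ^ (N.+1%:Z - m) * qbinom q N%:Z (m - 1).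
Proof.
have qN : q ^+ N.+1 = q ^ (N.+1%:Z - m) * q ^ m by rewrite -expfzDr // subrK.
rewrite !qbinomE qpochS qN inv_qfactB1.
have -> : N%:Z - m = N.+1%:Z - m - 1 by lia.
have -> : N%:Z - (m - 1) = N.+1%:Z - m by lia.
rewrite inv_qfactB1; ring.
Qed.

Lemma qbinomSr (N : nat) (m : int) :
  qbinom q N.+1%:Z m = qbinom q N%:Z (m - 1) + q ^ m * qbinom q N%:Z m.
Proof.
have qN : q ^+ N.+1 = q ^ (N.+1%:Z - m) * q ^ m by rewrite -expfzDr // subrK.
rewrite !qbinomE qpochS qN inv_qfactB1.
have -> : N%:Z - m = N.+1%:Z - m - 1 by lia.
have -> : N%:Z - (m - 1) = N.+1%:Z - m by lia.
rewrite inv_qfactB1; ring.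
Qed.

Definition tri_qbinom (L : nat) (a : int) : F :=
  q ^ tri a * qbinom q (2 * L%:Z + 1) (L%:Z - a).

Lemma tri_qbinom_rec (L : nat) (a : int) :
  tri_qbinom L.+1 a = (1 + q ^+ L.+1 ^+ 2) * tri_qbinom L a
    + q ^+ L.+1 * (tri_qbinom L (a - 1) + tri_qbinom L (a + 1)).
Proof.
have tri_pred : tri a = tri (a - 1) + a by rewrite -{1}(subrK 1 a) triD1 subrK.
have tri_succ : tri (a + 1) = tri (a - 1) + a + (a + 1) by rewrite triD1 tri_pred.
rewrite /tri_qbinom tri_succ tri_pred.
have -> : 2 * L.+1%:Z + 1 = (L.*2.+3)%:Z by lia.
have -> : 2 * L%:Z + 1 = (L.*2.+1)%:Z by lia.
(* One rule, then the other on both resulting terms, leaves only the q-binomials belonging to a - 1,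
   a and a + 1. *)
rewrite (qbinomSr L.*2.+2) !(qbinomSl L.*2.+1).
have -> : L.+1%:Z - a - 1 - 1 = L%:Z - (a + 1) by lia.
have -> : L.+1%:Z - a - 1 = L%:Z - a by lia.
have -> : L.+1%:Z - a = L%:Z - (a - 1) by lia.
have -> : (L.*2.+2)%:Z - (L%:Z - a) = L.+1%:Z + (a + 1) by lia.
have -> : (L.*2.+2)%:Z - (L%:Z - (a - 1)) = L.+1%:Z + a by lia.
have -> : L%:Z - (a - 1) = L.+1%:Z + (- a) by lia.
have qa0 : q ^ a != 0 by rewrite expfz_neq0.
rewrite !expfzDr // -!invr_expz -!exprnP.
by field.
Qed.

(** * Passing from base 1/q to base q *)

Lemma qpochV (n : nat) :
  qpoch q^-1 q^-1 n = (-1) ^+ n * q ^ (- tri n%:Z) * qpoch q q n.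
Proof.
elim: n => [|n IHn].
  by rewrite /qpoch !big_ord0 /tri mulr0 div0z oppr0 expr0z !mulr1.
have q_n0 : q ^+ n.+1 != 0 by rewrite expf_neq0.
have -> : qpoch q^-1 q^-1 n.+1 = qpoch q^-1 q^-1 n * (1 - (q ^+ n.+1)^-1).
  by rewrite /qpoch big_ord_recr /= -exprS exprVn.
have -> : q ^ (- tri n.+1%:Z) = q ^ (- tri n%:Z) / q ^+ n.+1.
  by rewrite exprnP invr_expz -expfzDr // -opprD intS [1 + _]addrC triD1.
rewrite IHn qpochS (exprS (-1)); move: (q ^+ n.+1) q_n0 (q ^ _) => x x_neq0 y.
by field.
Qed.

Lemma inv_qfactV (n : int) :
  inv_qfact q^-1 n = (-1) ^ n * q ^ tri n * e n.
Proof.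
have [n_lt0|] := ltP n 0; first by rewrite !inv_qfact_lt0 ?mulr0.
case: n => // n _; rewrite /inv_qfact /= qpochV !invfM.
by rewrite invr_expz opprK -exprVn invrN1 -exprnP.
Qed.

Lemma qT_m1 (r : F) (i : nat) (a : int) :
  r ^+ 2 = q -> qT q r (- 1) i a = trinomT i a.
Proof.
move=> r2; rewrite /qT qtrinomE /trinomT /trinom_sum !mulr_sumr; apply: eq_bigr => n _.
(* The exponent of [r] is even, so only powers of [r ^ 2 = q] occur. *)
have -> : i%:Z * (i%:Z - - 1) - a * (a - - 1) = 2 * (tri i%:Z - tri a).
  by rewrite [RHS]mulrC mulrBl !tri_half; ring.
rewrite -exprz_exp -[r ^ 2]/(r ^+ 2) r2 qpochV !inv_qfactV exprz_inv /tri_inv_qfact.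
set k : int := i%:Z - 2 * n%:Z - a.
have sgn : (-1) ^+ i * (-1) ^ n%:Z * (-1) ^ (n%:Z + a) * (-1) ^ k = 1 :> F.
  have n1 : -1 != 0 :> F by rewrite oppr_eq0 oner_eq0.
  rewrite exprnP -!expfzDr //.
  rewrite (_ : _ + k = 2 * i%:Z); last by rewrite /k; ring.
  by rewrite -exprz_exp -!exprnP sqrrN !expr1n.
(* All powers of q cancel except q^(tri k), which stays inside [tri_inv_qfact k]. *)
have qexp : q ^ (tri i%:Z - tri a) * q ^ (- (n%:Z * (n%:Z + (a - - 1)))) *
    q ^ (- tri i%:Z) * q ^ tri n%:Z * q ^ tri (n%:Z + a) = 1.
  rewrite -!expfzDr // triD (_ : _ + (_ + _ + _) = 0) ?expr0z //.
  have := tri_half n%:Z; rewrite opprK; lia.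
rewrite -[RHS]mulr1 -[X in _ = _ * X]qexp -[RHS]mulr1 -[X in _ = _ * X]sgn.
by ring.
Qed.

(** * Initial values and conclusion *)

Lemma trinomT0 (a : int) : trinomT 0 a = (a == 0)%:R.
Proof.
rewrite /trinomT /trinom_sum big_ord1 mulr0 subr0 sub0r add0r /tri_inv_qfact.
have [->|a_neq0] := eqVneq a 0.
  by rewrite oppr0 /tri mulr0 div0z /inv_qfact /= /qpoch !big_ord0 invr1 !mulr1.
have [a_lt0|a_ge0] := ltP a 0.
  by rewrite (inv_qfact_lt0 _ a_lt0) !(mulr0, mul0r).
by rewrite (inv_qfact_lt0 q (n := - a)) ?(mulr0, mul0r) //; lia.
Qed.

Lemma trinomT_transform0 (a : int) : trinomT_transform 0 a = (a == 0)%:R.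
Proof.
rewrite /trinomT_transform big_ord1 trinomT0 /qbinom_tri /tri_inv_qfact /tri.
by rewrite mulr0 div0z /inv_qfact /= /qpoch !big_ord0 invr1 !mul1r.
Qed.

(** The q-binomial of 1 over -a is 1 at a = 0 and a = -1, where [tri] vanishes, and 0 elsewhere. *)
Lemma tri_qbinom0 (a : int) : tri_qbinom 0 a = (a == 0)%:R + (a + 1 == 0)%:R.
Proof.
have q1 : 1 - q != 0 by rewrite subr_eq0 eq_sym -[q]expr1 q_nroot.
rewrite /tri_qbinom mulr0 add0r sub0r qbinomE /qpoch big_ord1 expr0 mulr1.
have [->|a_neq0] := eqVneq a 0.
  rewrite /tri /inv_qfact /= /qpoch !big_ord_recr !big_ord0 /= expr0.
  by rewrite !mulr1 !mul1r invr1 mul1r addr0 divff.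
have [a1|a_neq1] := eqVneq (a + 1) 0.
  have -> : a = - 1 by lia.
  rewrite /tri /inv_qfact /= /qpoch !big_ord_recr !big_ord0 /= expr0.
  by rewrite !mulr1 !mul1r invr1 mulr1 add0r divff.
have [a_gt0|a_le0] := ltP 0 a.
  by rewrite (inv_qfact_lt0 q (n := - a)) ?(mulr0, mul0r, addr0) //; lia.
by rewrite (inv_qfact_lt0 q (n := 1 - - a)) ?(mulr0, mul0r, addr0) //; lia.
Qed.

(** The common recurrence is linear with coefficients free of a, so the sum of two shifts satisfies
    it too. *)
Lemma trinomT_transformD1 (L : nat) (a : int) :
  trinomT_transform L a + trinomT_transform L (a + 1) = tri_qbinom L a.
Proof.
elim: L a => [|L IHL] a; first by rewrite !trinomT_transform0 tri_qbinom0.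
rewrite !trinomT_transform_rec tri_qbinom_rec -!IHL addrK subrK; ring.
Qed.

End QSeriesTheory.

Theorem theorem3p4 (F : fieldType) (q r : F)
    (hr : r ^+ 2 = q) (hq0 : q != 0)
    (hq1 : forall n : nat, (0 < n)%N -> q ^+ n != 1)
    (L : nat) (a : int) :
  \sum_(i \in [set: nat])
    q ^+ 'C(i.+1, 2) * qbinom q L%:Z i%:Z
      * (qT q r (- 1) i a + qT q r (- 1) i (a + 1))
  = q ^ ((a + 1) * a %/ 2)%Z * qbinom q (2 * L%:Z + 1) (L%:Z - a).
Proof.
have ltqbinom (i : nat) : (L < i)%N -> qbinom q L%:Z i%:Z = 0 by apply: qbinom_gt.
rewrite (@fsbig_nat_ord _ _ L.+1); last by move=> i /ltqbinom ->; rewrite mulr0 mul0r.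
have -> : q ^ ((a + 1) * a %/ 2)%Z * qbinom q (2 * L%:Z + 1) (L%:Z - a) =
    tri_qbinom q L a by [].
rewrite -trinomT_transformD1 // /trinomT_transform -big_split /=.
apply: eq_bigr => i _; rewrite !(qT_m1 hq0 _ _ hr) -[RHS]mulrDr; congr (_ * _).
by rewrite qbinomE /qbinom_tri /tri_inv_qfact tri_nat -exprnP; ring.
Qed.
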